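(* Let $\mathscr{X}$ be a complex Banach space and let $A,B\in\mathcal{L}(\mathscr{X})$. Suppose that the elementary operator $\Upsilon_{A,B}: T\mapsto T+ATB$ on $\mathcal{L}(\mathscr{X})$ is invertible and of length $2$. Then $\Upsilon_{A,B}^{-1}$ is an elementary operator if and only if either $A$ or $B$ is algebraic. Moreover, in this case, the length of $\Upsilon_{A,B}^{-1}$ is $\ell(\Upsilon_{A,B}^{-1})=\min\{\deg(A),\deg(B)\}$.
   Context: $\mathcal{L}(\mathscr{X})$ is the algebra of bounded linear operators on $\mathscr{X}$. A multiplication operator on $\mathcal{L}(\mathscr{X})$ is a map $\mathrm{M}_{A,B}:T\mapsto ATB$ with $A,B\in\mathcal{L}(\mathscr{X})$. An elementary operator on $\mathcal{L}(\mathscr{X})$ is a finite sum of multiplication operators; its length $\ell(\cdot)$ is the minimum number of multiplication operators needed to represent it. Invertibility of an elementary operator means invertibility as a bounded linear operator on $\mathcal{L}(\mathscr{X})$. An operator $T$ is algebraic if $p(T)=0$ for some nonzero complex polynomial $p$; then $\deg(T)$ is the degree of its minimal polynomial, and $\deg(T)=\infty$ if $T$ is not algebraic. *)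

(* Defs.v *)
(* The complex field is R[i], for an arbitrary model R : realType of the reals. *)
From HB Require Import structures.
From mathcomp Require Import all_boot all_order all_algebra.
From mathcomp Require Import complex.
From mathcomp Require Import all_classical all_reals all_analysis.

Set Implicit Arguments.
Unset Strict Implicit.
Unset Printing Implicit Defensive.

Import Order.TTheory GRing.Theory Num.Theory.
Import numFieldNormedType.Exports.

Local Open Scope classical_set_scope.
Local Open Scope ring_scope.
Local Open Scope complex_scope.

Definition bounded_linear (R : realType) (V : normedModType R[i])
    (f : V -> V) : Prop :=
  linear f /\ exists M : R[i], forall x, `|f x| <= M * `|x|.

Record bop (R : realType) (V : normedModType R[i]) := Bop {
  bop_fun :> V -> V ;
  bop_subproof : `[< bounded_linear bop_fun >] }.

Notation "''L' ( V )" := (bop V) (at level 8, format "''L' ( V )").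

Section BopLmodule.
Context {R : realType} {V : normedModType R[i]}.

HB.instance Definition _ := [isSub of 'L(V) for @bop_fun R V].
HB.instance Definition _ := [Choice of 'L(V) by <:].

Implicit Types (S T U : 'L(V)) (x y : V) (a : R[i]).

Lemma bopP T : bounded_linear T.
Proof. exact/asboolP/(bop_subproof T). Qed.

Lemma bop_linear T : linear T. Proof. by have [] := bopP T. Qed.

HB.instance Definition _ T :=
  GRing.isLinear.Build R[i] V V *:%R (bop_fun T) (bop_linear T).

Definition to_bop (f : V -> V) (hf : bounded_linear f) : 'L(V) :=
  Bop (introT (asboolP _) hf).

Lemma bop_ext S T : S =1 T -> S = T.
Proof. by move=> ST; apply/val_inj/funext. Qed.

Lemma ex_bound_ge0 T :
  exists2 M : R[i], 0 <= M & forall x, `|T x| <= M * `|x|.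
Proof.
have [_ [M hM]] := bopP T.
have [[z z0]|V0] := pselect (exists x : V, x != 0); last first.
  exists 0 => // x; have [->|/eqP x0] := eqVneq x 0.
    by rewrite linear0 !normr0 mulr0.
  by case: V0; exists x; apply/eqP.
exists M => //.
by rewrite -(pmulr_lge0 _ (_ : 0 < `|z|)) ?normr_gt0// (le_trans _ (hM z)).
Qed.

Fact bop_submod_closed :
  GRing.subsemimod_closed [pred f : V -> V | `[< bounded_linear f >]].
Proof.
split.
  split; first by apply/asboolP; split;
    [move=> a x y /=; rewrite scaler0 addr0
    |exists 0 => x; rewrite normr0 mul0r].
  move=> f g /asboolP[lf [M hM]] /asboolP[lg [N hN]]; apply/asboolP; split.
    by move=> a x y; rewrite !fctE lf lg scalerDr addrACA.
  exists (M + N) => x; rewrite mulrDl (le_trans (ler_normD _ _))//.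
  exact: lerD.
move=> a f /asboolP[lf [M hM]]; apply/asboolP; split.
  by move=> b x y; rewrite !fctE lf scalerDr !scalerA mulrC.
by exists (`|a| * M) => x; rewrite normrZ -mulrA ler_wpM2l.
Qed.

HB.instance Definition _ :=
  GRing.SubChoice_isSubLmodule.Build R[i] (V -> V) _ 'L(V) bop_submod_closed.

Lemma bop0E x : (0 : 'L(V)) x = 0. Proof. by []. Qed.
Lemma bopDE S T x : (S + T) x = S x + T x. Proof. by []. Qed.
Lemma bopNE T x : (- T) x = - T x. Proof. by []. Qed.
Lemma bopZE a T x : (a *: T) x = a *: T x. Proof. by []. Qed.

End BopLmodule.

Section BopNorm.
Context {R : realType} {V : normedModType R[i]}.
Implicit Types (S T U : 'L(V)) (x y : V) (a : R[i]).

(* The norm of a module over R[i] takes its values in R[i], on the real axis. *)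
Definition opnorm T : R[i] :=
  (sup [set complex.Re `|T x| | x in [set x : V | `|x| <= 1]])%:C.

Let Re_norm x : (complex.Re `|x|)%:C = `|x|.
Proof. by rewrite RRe_real// normr_real. Qed.

Let opnorm_set T := [set complex.Re `|T x| | x in [set x : V | `|x| <= 1]].

Let opnorm_set0 T : opnorm_set T !=set0.
Proof. by exists (complex.Re `|T 0|); exists 0 => //=; rewrite normr0. Qed.

Let opnorm_ub T (M : R[i]) : 0 <= M -> (forall x, `|T x| <= M * `|x|) ->
  ubound (opnorm_set T) (complex.Re M).
Proof.
move=> M0 hM _ [x /= x1 <-].
rewrite -lecR Re_norm RRe_real ?ger0_real// (le_trans (hM x))//.
by rewrite ler_piMr.
Qed.

Lemma opnorm_ge0 T : 0 <= opnorm T.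
Proof.
have [M M0 hM] := ex_bound_ge0 T.
rewrite /opnorm ler0c; apply: (@le_trans _ _ (complex.Re `|T 0|)).
  by rewrite linear0 normr0.
apply: ub_le_sup; first by exists (complex.Re M); exact: opnorm_ub.
by exists 0 => //=; rewrite normr0.
Qed.

Lemma opnorm_le T (M : R[i]) : 0 <= M -> (forall x, `|T x| <= M * `|x|) ->
  opnorm T <= M.
Proof.
move=> M0 hM; rewrite -[leRHS](RRe_real (ger0_real M0)) lecR.
by apply: ge_sup; [exact: opnorm_set0|exact: opnorm_ub].
Qed.

Lemma le_opnorm T x : `|T x| <= opnorm T * `|x|.
Proof.
have [M M0 hM] := ex_bound_ge0 T.
have [->|x0] := eqVneq x 0; first by rewrite linear0 !normr0 mulr0.
have nx0 : 0 < `|x| by rewrite normr_gt0.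
rewrite -ler_pdivrMr//.
have -> : `|T x| / `|x| = `|T (`|x|^-1 *: x)|.
  by rewrite linearZ normrZ normfV normr_id mulrC.
rewrite -Re_norm lecR; apply: ub_le_sup.
  by exists (complex.Re M); exact: opnorm_ub.
by exists (`|x|^-1 *: x) => //=; rewrite normrZ normfV normr_id mulVf ?gt_eqF.
Qed.

Let opnormD S T : opnorm (S + T) <= opnorm S + opnorm T.
Proof.
apply: opnorm_le => [|x]; first by rewrite addr_ge0// opnorm_ge0.
by rewrite bopDE mulrDl (le_trans (ler_normD _ _))// lerD// le_opnorm.
Qed.

Let opnormZ_le a T : opnorm (a *: T) <= `|a| * opnorm T.
Proof.
apply: opnorm_le => [|x]; first by rewrite mulr_ge0// opnorm_ge0.
by rewrite bopZE normrZ -mulrA ler_wpM2l// le_opnorm.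
Qed.

Let opnormZ a T : opnorm (a *: T) = `|a| * opnorm T.
Proof.
apply/eqP; rewrite eq_le opnormZ_le/=.
have [->|a0] := eqVneq a 0; first by rewrite normr0 mul0r opnorm_ge0.
rewrite -ler_pdivlMl ?normr_gt0// -normfV (le_trans _ (opnormZ_le _ _))//.
by rewrite scalerA mulVf// scale1r.
Qed.

Let opnorm0_eq0 T : opnorm T = 0 -> T = 0.
Proof.
move=> T0; apply: bop_ext => x; apply/eqP; rewrite bop0E -normr_le0.
by rewrite (le_trans (le_opnorm T x))// T0 mul0r.
Qed.

HB.instance Definition _ :=
  Lmodule_isNormed.Build R[i] 'L(V) opnormD opnormZ opnorm0_eq0.

Lemma bop_normE T : `|T| = opnorm T. Proof. by []. Qed.

Lemma le_bop_norm T x : `|T x| <= `|T| * `|x|.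
Proof. exact: le_opnorm. Qed.

End BopNorm.

Section BopRing.
Context {R : realType} {V : normedModType R[i]}.
Implicit Types (S T U : 'L(V)) (x : V) (a : R[i]).

Fact bop1_subproof : bounded_linear (@idfun V).
Proof. by split=> //; exists 1 => x; rewrite mul1r. Qed.

Fact bopM_subproof S T : bounded_linear (S \o T).
Proof.
split=> [a x y|]; first by rewrite /= !linearP.
exists (`|S| * `|T|) => x; rewrite (le_trans (le_bop_norm _ _))// -mulrA.
by rewrite ler_wpM2l// le_bop_norm.
Qed.

Let bop1 := to_bop bop1_subproof.
Let bopM S T := to_bop (bopM_subproof S T).

Let bopMA : associative bopM. Proof. by move=> S T U; exact: bop_ext. Qed.
Let bop1M : left_id bop1 bopM. Proof. by move=> S; exact: bop_ext. Qed.
Let bopM1 : right_id bop1 bopM. Proof. by move=> S; exact: bop_ext. Qed.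
Let bopMDl : left_distributive bopM +%R.
Proof. by move=> S T U; exact: bop_ext. Qed.
Let bopMDr : right_distributive bopM +%R.
Proof. by move=> S T U; apply: bop_ext => x; exact: linearD. Qed.

(* Not an nzRingType, since V may be the zero space. *)
HB.instance Definition _ :=
  GRing.Zmodule_isPzRing.Build 'L(V) bopMA bop1M bopM1 bopMDl bopMDr.

Lemma bop1E x : (1 : 'L(V)) x = x. Proof. by []. Qed.
Lemma bopME S T x : (S * T) x = S (T x). Proof. by []. Qed.

Lemma bop_normM S T : `|S * T| <= `|S| * `|T|.
Proof.
apply: opnorm_le => [|x]; first exact: mulr_ge0.
rewrite bopME (le_trans (le_bop_norm _ _))// -mulrA.
by rewrite ler_wpM2l// le_bop_norm.
Qed.

Lemma bopZAl a S T : a *: (S * T) = (a *: S) * T.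
Proof. exact: bop_ext. Qed.

Lemma bopZAr a S T : a *: (S * T) = S * (a *: T).
Proof. by apply: bop_ext => x; rewrite bopME !bopZE bopME linearZ. Qed.

End BopRing.

Section Invertible.
Context {A : pzRingType}.
Implicit Types (x y z : A).

Definition is_inverse x y : Prop := y * x = 1 /\ x * y = 1.

Definition invertible x : Prop := exists y, is_inverse x y.

(* Junk value 0 when x is not invertible. *)
Definition inverse x : A := xget 0 [set y | is_inverse x y].

Lemma is_inverse_uniq x y z : is_inverse x y -> is_inverse x z -> y = z.
Proof. by move=> [yx _] [_ xz]; rewrite -[y]mulr1 -xz mulrA yx mul1r. Qed.

Lemma inverseP x : invertible x -> is_inverse x (inverse x).
Proof. by move=> [y xy]; rewrite /inverse; case: xgetP => // /(_ y). Qed.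

End Invertible.

Section Elementary.
Context {R : realType} {X : normedModType R[i]}.
Implicit Types (A B S T : 'L(X)) (Phi Psi : 'L('L(X))).

Fact mulop_subproof A B : bounded_linear (fun T : 'L(X) => A * T * B).
Proof.
split=> [a S T|].
  by rewrite mulrDr mulrDl -bopZAr -bopZAl.
exists (`|A| * `|B|) => T; rewrite (le_trans (bop_normM _ _))//.
by rewrite mulrAC ler_wpM2r// bop_normM.
Qed.

Definition mulop A B : 'L('L(X)) := to_bop (mulop_subproof A B).

Definition sum_of_mulops Phi (n : nat) : Prop :=
  exists a b : 'I_n -> 'L(X), Phi = \sum_(i < n) mulop (a i) (b i).

Definition elementary Phi : Prop := exists n, sum_of_mulops Phi n.

(* The least n for which Phi is a sum of n multiplication operators;
   +oo when Phi is not elementary. *)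
Definition oplength Phi : \bar R :=
  if pselect (exists n, `[< sum_of_mulops Phi n >]) is left ex
  then (ex_minn ex)%:R%:E else +oo%E.

Definition Upsilon A B : 'L('L(X)) := 1 + mulop A B.

Lemma UpsilonE A B T : Upsilon A B T = T + A * T * B. Proof. by []. Qed.

End Elementary.

Section Algebraic.
Context {R : realType} {X : normedModType R[i]}.
Implicit Types (T : 'L(X)) (p q m : {poly R[i]}).

(* p(T); horner_alg would require 'L(X) to be a nontrivial ring. *)
Definition poly_bop p T : 'L(X) := \sum_(i < size p) p`_i *: T ^+ i.

Definition algebraic T : Prop := exists2 p, p != 0 & poly_bop p T = 0.

Definition is_minpoly T m : Prop :=
  [/\ m \is monic, poly_bop m T = 0 &
      forall q, q != 0 -> poly_bop q T = 0 -> (size m <= size q)%N].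

(* Junk value 0 when T is not algebraic. *)
Definition minpoly T : {poly R[i]} := xget 0 [set m | is_minpoly T m].

Definition opdeg T : \bar R :=
  if `[< algebraic T >] then (size (minpoly T)).-1%:R%:E else +oo%E.

Lemma poly_bop_widen p T n : (size p <= n)%N ->
  poly_bop p T = \sum_(i < n) p`_i *: T ^+ i.
Proof.
move=> pn; rewrite /poly_bop (big_ord_widen _ (fun i => p`_i *: T ^+ i) pn).
rewrite big_mkcond; apply: eq_bigr => i _; case: ltnP => // ip.
by rewrite nth_default// scale0r.
Qed.

Lemma poly_bopZ a p T : poly_bop (a *: p) T = a *: poly_bop p T.
Proof.
rewrite (poly_bop_widen _ (size_scale_leq _ _)) scaler_sumr.
by apply: eq_bigr => i _; rewrite coefZ scalerA.
Qed.

Lemma minpolyP T : algebraic T -> is_minpoly T (minpoly T).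
Proof.
move=> [p p0 pT].
have ex : exists n, `[< exists q, [/\ q != 0, poly_bop q T = 0 & size q = n] >].
  by exists (size p); apply/asboolP; exists p.
case: (ex_minnP ex) => _ /asboolP[q [q0 qT <-]] qmin.
suff mq : is_minpoly T ((lead_coef q)^-1 *: q).
  by rewrite /minpoly; case: xgetP => // /(_ _ mq).
have lq0 : (lead_coef q)^-1 != 0 by rewrite invr_eq0 lead_coef_eq0.
split.
- by rewrite monicE lead_coefZ mulVf// lead_coef_eq0.
- by rewrite poly_bopZ qT scaler0.
- move=> r r0 rT; rewrite size_scale//; apply: qmin.
  by apply/asboolP; exists r.
Qed.

End Algebraic.

(* Main.v *)
Require Import Defs.
From HB Require Import structures.
From mathcomp Require Import all_boot all_order all_algebra.
From mathcomp Require Import complex zify.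
From mathcomp Require Import all_classical all_reals all_analysis.
Import Order.TTheory GRing.Theory Num.Theory.
Import numFieldNormedType.Exports.
Local Open Scope ring_scope.
Set Implicit Arguments.
Unset Strict Implicit.
Unset Printing Implicit Defensive.

(** Write M(C, D) for the map T |-> C T D and Upsilon = 1 + M(A, B).

Lengths are computed by a tensor-rank principle: if the a_k are linearly
independent and so are the b_k, then a sum of d maps M(a_k, b_k) is not a sum
of fewer than d multiplication operators. Testing such a sum on rank-one
operators f (x) y and applying a functional g to its value at x gives the
numbers sum_k g (a_k y) f (b_k x), and finitely many tests turn the two
independent families into matrices of rank d ([mulops_rank]). Hahn-Banach
provides the functionals.

Suppose that A is algebraic, of degree d at most deg B, with minimal polynomial
the product of the factors X - x_j, j < d. Each x_j satisfies A Q = Q A = x_j Q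
for some Q <> 0, and on the operators of the form Q T the map Upsilon acts as
right multiplication by 1 + x_j B; invertibility of Upsilon therefore passes
to 1 + x_j B ([eigen_left_invertible]). Let p_k be the product of the X - x_i,
i < k, and n_k = (- X)^k times the product of the 1 + x_j X, k < j < d. The sum
of the M(p_k(A), n_k(B)) is sent by Upsilon to a telescoping sum
([Upsilon_newton_dual]) of which only right multiplication by
W = prod_j (1 + x_j B) remains, as p_d(A) = 0. So Upsilon^-1 is the sum of the
d operators M(p_k(A), W^-1 n_k(B)). The p_k have increasing degrees and the n_k
increasing orders of vanishing at 0, all degrees being less than d; as
d <= deg A and d <= deg B, both families stay independent after evaluation, and
the length is exactly d. The case deg B <= deg A is the mirror image.

Conversely, the same telescoping with all x_j = 0 exhibits the sum of the
M(A^k, (- B)^k), k < m, as Upsilon^-1 (1 - M(A^m, (- B)^m)). If Upsilon^-1 has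
length n this is a sum of 2 n multiplication operators, which for m = 2 n + 1
contradicts the rank principle unless A or B is algebraic
([elementary_inverse_algebraic]). *)

(** * Hahn-Banach over the complex numbers *)

Section Sublinear.
Context {R : realType} {V : lmodType R[i]}.
Implicit Types (x y z : V) (p q : V -> R).
Local Open Scope complex_scope.
Local Open Scope classical_set_scope.

(** Real scalars act through their embedding in the complex numbers. The
inequality in the second clause is the form that passes to infima; applied to t
and to its inverse it gives equality. *)
Definition sublinear q :=
  (forall x y, q (x + y) <= q x + q y) /\
  (forall (t : R) x, 0 < t -> q (t%:C *: x) <= t * q x).

Lemma sublinearZ q (t : R) x : sublinear q -> 0 < t ->
  q (t%:C *: x) = t * q x.
Proof.
move=> [_ qZ] t0; apply/eqP; rewrite eq_le qZ//= mulrC -ler_pdivlMr//.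
have := qZ t^-1 (t%:C *: x); rewrite invr_gt0 => /(_ t0).
by rewrite scalerA -rmorphM /= mulVf ?gt_eqF// scale1r mulrC.
Qed.

Lemma sublinear0 q : sublinear q -> q 0 = 0.
Proof.
move=> sq; have := sublinearZ 0 sq (ltr0n _ 2).
rewrite scaler0 mulr_natl mulr2n => /eqP.
by rewrite -subr_eq subrr eq_sym => /eqP.
Qed.

(** Both infima in the proof of Hahn-Banach, over a chain and along a ray, are
sublinear for the same reason: their families of values are stable, up to
decreasing them, under sums and positive homotheties. *)
Lemma inf_sublinear (S : V -> set R) :
  (forall x, S x !=set0) -> (forall x, has_lbound (S x)) ->
  (forall x y a b, S x a -> S y b -> exists2 c, S (x + y) c & c <= a + b) ->
  (forall (t : R) x a, 0 < t -> S x a ->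
    exists2 c, S (t%:C *: x) c & c <= t * a) ->
  sublinear (fun x => inf (S x)).
Proof.
move=> S0 Sl SD SZ; split.
  move=> x y; rewrite -lerBlDl; apply: lb_le_inf => // b Sb.
  rewrite lerBlDl -lerBlDr; apply: lb_le_inf => // a Sa.
  rewrite lerBlDr; have [c Sc ca] := SD _ _ _ _ Sa Sb.
  by apply: le_trans ca; apply: ge_inf.
move=> t x t0; rewrite mulrC -ler_pdivrMr//; apply: lb_le_inf => // a Sa.
rewrite ler_pdivrMr// mulrC; have [c Sc ca] := SZ _ _ _ t0 Sa.
by apply: le_trans ca; apply: ge_inf.
Qed.

Lemma sublinear_lower q x y (t : R) : sublinear q -> 0 <= t ->
  - q (- x) <= q (x + t%:C *: y) - t * q y.
Proof.
move=> sq; have [qD _] := sq.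
rewrite lerBrDr addrC -lerBrDr opprK => t0.
have -> : t * q y = q (t%:C *: y).
  have [->|tn0] := eqVneq t 0; first by rewrite mul0r scale0r sublinear0.
  by rewrite sublinearZ// lt0r tn0.
by rewrite -{1}[t%:C *: y](addKr x) addrC qD.
Qed.

(** The function x |-> inf over t >= 0 of q (x + t y) - t q(y) lies below q, by
t = 0, and below q (x + y) - q y, by t = 1. A minimal q equals it, which gives q
x + q y <= q (x + y): minimal sublinear functions are additive. *)
Lemma sublinear_drop q y : sublinear q ->
  exists q', [/\ sublinear q', forall x, q' x <= q x &
    forall x, q' x <= q (x + y) - q y].
Proof.
move=> sq; have [qD qZ] := sq.
pose S x := [set q (x + t%:C *: y) - t * q y | t in [set t | 0 <= t]].
have Sl x : has_lbound (S x).
  by exists (- q (- x)) => _ [t /= t0 <-]; apply: sublinear_lower.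
exists (fun x => inf (S x)); split.
- apply: inf_sublinear => //.
  + by move=> x; exists (q (x + 0%:C *: y) - 0 * q y); exists 0 => /=.
  + move=> x z _ _ [s /= s0 <-] [t /= t0 <-].
    exists (q (x + z + (s + t)%:C *: y) - (s + t) * q y).
      by exists (s + t) => //=; rewrite addr_ge0.
    rewrite rmorphD /= scalerDl [x + z + _]addrACA mulrDl opprD [leRHS]addrACA.
    by rewrite lerD2r; exact: qD.
  + move=> t x _ t0 [s /= s0 <-].
    exists (q (t%:C *: x + (t * s)%:C *: y) - t * s * q y).
      by exists (t * s) => //=; rewrite mulr_ge0// ltW.
    rewrite mulrBr mulrA. rewrite lerD2r rmorphM /= -scalerA -scalerDr.
    exact: qZ.
- move=> x; apply: ge_inf => //; exists 0 => //=.
  by rewrite scale0r addr0 mul0r subr0.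
- move=> x; apply: ge_inf => //; exists 1 => //=.
  by rewrite scale1r mul1r.
Qed.

(** Zorn: a chain below p has its pointwise infimum as lower bound. It is finite
because every member q satisfies q x >= - q (- x) >= - p (- x). *)
Lemma minimal_sublinear p : sublinear p ->
  exists q, [/\ sublinear q, forall x, q x <= p x &
    forall q', sublinear q' -> (forall x, q' x <= q x) -> q' = q].
Proof.
move=> sp.
pose T := {q : V -> R | sublinear q /\ forall x, q x <= p x}.
pose le_T (s t : T) := `[< forall x, sval t x <= sval s x >].
have t0 : T by exists p.
have [|r s t /asboolP rs /asboolP st|A Atot|[q [sq qp]] qmin] :=
    @ZL_preorder T t0 le_T.
- by move=> t; apply/asboolP.
- by apply/asboolP => x; apply: le_trans (st x) (rs x).
- have [[a Aa]|A0] := pselect (A !=set0); last first.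
    by exists t0 => s As; case: A0; exists s.
  pose S x := [set sval s x | s in A].
  have Sl x : has_lbound (S x).
    exists (- p (- x)) => _ [[s [ss sp']] As <-] /=.
    have := sublinear_lower x 0 ss (lexx 0).
    rewrite scaler0 addr0 mul0r subr0; apply: le_trans.
    by rewrite lerN2.
  have sS : sublinear (fun x => inf (S x)).
    apply: inf_sublinear => //.
    + by move=> x; exists (sval a x); exists a.
    + move=> x y _ _ [s As <-] [t At <-].
      have [/asboolP st|/asboolP st] := Atot _ _ As At.
      * exists (sval t (x + y)); first by exists t.
        have [[tD _] _] := svalP t; apply: le_trans (tD _ _) _.
        by rewrite lerD2r.
      * exists (sval s (x + y)); first by exists s.
        have [[tD _] _] := svalP s; apply: le_trans (tD _ _) _.
        by rewrite lerD2l.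
    + move=> t x _ tgt0 [s As <-].
      exists (sval s (t%:C *: x)); first by exists s.
      by have [[_ sZ] _] := svalP s; apply: sZ.
  have Sp x : inf (S x) <= p x.
    apply: (@le_trans _ _ (sval a x)); last by have [_] := svalP a.
    by apply: ge_inf => //; exists a.
  exists (exist _ (fun x => inf (S x)) (conj sS Sp)) => s As.
  by apply/asboolP => x /=; apply: ge_inf => //; exists s.
exists q; split=> // q' sq' q'q.
have q'p x : q' x <= p x by apply: le_trans (q'q x) (qp x).
have /asboolP /= qq' :=
  qmin (exist _ q' (conj sq' q'p)) (introT (asboolP _) q'q).
by apply/funext => x; apply/eqP; rewrite eq_le q'q qq'.
Qed.

(** A minimal sublinear function below p is real-linear. Dropping p along z
before minimizing yields u (- z) <= p 0 - p z = - p z, which pins the value at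
z. *)
Lemma real_hahn_banach p z : sublinear p ->
  exists u : V -> R, [/\ forall x y, u (x + y) = u x + u y,
    forall (t : R) x, u (t%:C *: x) = t * u x,
    forall x, u x <= p x & u z = p z].
Proof.
move=> sp; have [pz [spz pzp pzN]] := sublinear_drop z sp.
have [u [su upz umin]] := minimal_sublinear spz.
have uD x y : u (x + y) = u x + u y.
  have [uy [suy uyu uyN]] := sublinear_drop y su.
  apply/eqP; rewrite eq_le su.1/= -lerBrDr.
  by rewrite -{1}(umin _ suy uyu) uyN.
have u0 := sublinear0 su.
have uN x : u (- x) = - u x.
  by apply/eqP; rewrite -addr_eq0 addrC -uD subrr u0.
exists u; split=> //.
- move=> t x; have [t0|t0|->] := ltrgtP t 0; last by rewrite scale0r mul0r.
    have -> : t%:C *: x = - ((- t)%:C *: x) by rewrite rmorphN scaleNr opprK.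
    by rewrite uN sublinearZ ?oppr_gt0// mulNr opprK.
  by rewrite sublinearZ.
- by move=> x; apply: le_trans (upz x) (pzp x).
- apply/eqP; rewrite eq_le (le_trans (upz z) (pzp z))/= -lerN2 -uN.
  apply: le_trans (upz _) _; apply: le_trans (pzN _) _.
  by rewrite addNr sublinear0// sub0r.
Qed.

End Sublinear.

Section HahnBanach.
Context {R : realType} {V : lmodType R[i]}.
Local Open Scope complex_scope.

(** A real-linear u <= p is the real part of the complex functional f x = u x -
i u (i x). Rotating x so that f x becomes a nonnegative real turns u <= p into
|f x| <= p x. *)
Lemma hahn_banach (p : V -> R) (z : V) :
  (forall x y, p (x + y) <= p x + p y) ->
  (forall a x, (p (a *: x))%:C = `|a| * (p x)%:C) ->
  exists f : V -> R[i], [/\ scalar f, forall x, `|f x| <= (p x)%:C &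
    f z = (p z)%:C].
Proof.
move=> pD pZ.
have sp : sublinear p.
  split=> // t x t0; rewrite -lecR pZ rmorphM /= ger0_norm// ler0c.
  exact: ltW.
have [u [uD uZ up uz]] := real_hahn_banach z sp.
have uN x : u (- x) = - u x.
  by rewrite -scaleN1r -[-1](rmorphN1 (real_complex R)) uZ mulN1r.
pose f x : R[i] := (u x) -i* (u ('i *: x)).
have fD x y : f (x + y) = f x + f y.
  by apply/eqP; rewrite eq_complex /= scalerDr !uD opprD !eqxx.
have fR t x : f (t%:C *: x) = t%:C * f x.
  apply/eqP; rewrite eq_complex /= scalerA [_ * t%:C]mulrC -scalerA !uZ.
  by rewrite !mul0r subr0 addr0 mulrN !eqxx.
have fi x : f ('i *: x) = 'i * f x.
  apply/eqP; rewrite eq_complex /= scalerA -expr2 sqr_i scaleN1r uN.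
  by rewrite !mul0r !mul1r !add0r !opprK !eqxx.
have fZ a x : f (a *: x) = a * f x.
  by rewrite [a]complexE scalerDl fD -scalerA fi !fR mulrDl mulrA.
have fp x : `|f x| <= (p x)%:C.
  have [->|fx0] := eqVneq (f x) 0.
    rewrite normr0 ler0c.
    have := pD x (- x); rewrite subrr.
    have -> : p (- x) = p x.
      by apply: (@complexI R); rewrite -scaleN1r pZ normrN1 mul1r.
    have -> : p 0 = 0.
      by apply: (@complexI R); rewrite -(scale0r 0) pZ normr0 mul0r.
    by rewrite -mulr2n pmulrn_lge0.
  (* c is the rotation making f (c x) real, so that f (c x) = u (c x) *)
  pose c := `|f x| / f x.
  have c1 : `|c| = 1 by rewrite normf_div normr_id divff ?normr_eq0.
  have fcx : f (c *: x) = `|f x| by rewrite fZ divfK.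
  have := up (c *: x); rewrite -lecR pZ c1 mul1r; apply: le_trans.
  rewrite -fcx -[X in X <= _]RRe_real ?fcx ?normr_real//.
  by rewrite -fcx.
exists f; split=> //; first by move=> a x y; rewrite fD fZ.
have pz0 : 0 <= (p z)%:C by apply: le_trans (fp z).
have := fp z; rewrite -ler_sqr ?nnegrE// -add_Re2_Im2 -rmorphXn lecR /= uz.
rewrite gerDl => fz0; apply/eqP; rewrite eq_complex /= uz eqxx /=.
by rewrite -sqrf_eq0 eq_le fz0 sqr_ge0.
Qed.

End HahnBanach.

(** * Functionals and rank-one operators *)

Section Functional.
Context {R : realType} {X : normedModType R[i]}.
Implicit Types (x y z : X) (S T : 'L(X)).
Local Open Scope complex_scope.

(** Functionals of norm at most 1; their multiples are all the bounded ones, so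
they suffice for separation. *)
Record functional := Functional {
  functional_fun :> X -> R[i];
  functional_scalar : scalar functional_fun;
  functional_le : forall x, `|functional_fun x| <= `|x| }.

HB.instance Definition _ (g : functional) :=
  GRing.isLinear.Build R[i] X R[i] *%R g (functional_scalar g).

Lemma Re_norm x : (complex.Re `|x|)%:C = `|x|.
Proof. by rewrite RRe_real// normr_real. Qed.

Lemma norming_functional z : exists g : functional, g z = `|z|.
Proof.
have [||f [fS fle fz]] := hahn_banach (p := fun x => complex.Re `|x|) z.
- by move=> x y; rewrite -lecR rmorphD /= !Re_norm ler_normD.
- by move=> a x; rewrite !Re_norm normrZ.
have fle' x : `|f x| <= `|x| by rewrite -[leRHS]Re_norm.
by exists (Functional fS fle'); rewrite /= fz Re_norm.
Qed.

Lemma functional_separate z : (forall g : functional, g z = 0) -> z = 0.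
Proof.
move=> z0; have [g gz] := norming_functional z.
by apply/normr0_eq0; rewrite -gz z0.
Qed.

Fact rank1_subproof (g : functional) z : bounded_linear (fun x => g x *: z).
Proof.
split=> [a x y|]; first by rewrite linearP scalerDl scalerA.
exists `|z| => x; rewrite normrZ mulrC ler_wpM2l//.
exact: functional_le.
Qed.

Definition rank1 (g : functional) z : 'L(X) := to_bop (rank1_subproof g z).

Lemma norm_rank1 g z : `|rank1 g z| <= `|z|.
Proof.
by apply: opnorm_le => // x; rewrite normrZ mulrC ler_wpM2l// functional_le.
Qed.

End Functional.
Arguments functional {R} X.

(** * Tensor rank of sums of multiplication operators *)

Section Sampling.

(** Take a sample of points of maximal rank r. If r < d, some nonzero
combination of the f k vanishes on the sample but, by independence, not at some
point t; adding t to the sample raises the rank. *)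
Lemma row_free_sample (F : fieldType) (S : Type) (d : nat)
    (f : 'I_d -> S -> F) :
  (forall mu : 'I_d -> F, (forall s, \sum_(k < d) mu k * f k s = 0) ->
    forall k, mu k = 0) ->
  exists m (s : 'I_m -> S), row_free (\matrix_(k < d, l < m) f k (s l)).
Proof.
move=> find.
have step r : (r <= d)%N -> exists m (s : 'I_m -> S),
    (r <= \rank (\matrix_(k < d, l < m) f k (s l)))%N.
  elim: r => [_|r IHr rd].
    by exists 0%N, (fun i : 'I_0 => False_rect S (notF (ltn_ord i))).
  have [m [s rk]] := IHr (ltnW rd).
  set M := (\matrix_(_, _) _) in rk.
  have [rM|rM] := ltnP r (\rank M); first by exists m, s.
  have: kermx M != 0.
    rewrite -mxrank_eq0 mxrank_ker subn_eq0 -ltnNge.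
    exact: leq_ltn_trans rM rd.
  case/rowV0Pn => mu /sub_kermxP muM mu0.
  have [t mut] : exists t, \sum_(k < d) mu 0 k * f k t != 0.
    apply: contrapT => nex; case/eqP: mu0; apply/rowP => k; rewrite mxE.
    apply: (find (fun k => mu 0 k)) => s'; apply/eqP.
    apply: contrapT => /negP ns.
    by apply: nex; exists s'.
  exists (m + 1)%N, (fun l : 'I_(m + 1) =>
    match fintype.split l with inl i => s i | inr _ => t end).
  set N := (\matrix_(_, _) _).
  have NE : N = row_mx M (\col_k f k t).
    apply/matrixP => k l; rewrite !mxE.
    by case: fintype.splitP => l' _; rewrite mxE.
  apply: (leq_ltn_trans rk); rewrite ltnNge; apply/negP => rNM.
  (* equal ranks would force equal kernels, but mu kills M and not N *)
  have kNM : (kermx N <= kermx M)%MS.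
    apply/sub_kermxP; have := mulmx_ker N; rewrite NE mul_mx_row.
    by rewrite -row_mx0 => /eq_row_mx[].
  have kMN : (kermx M <= kermx N)%MS.
    by rewrite -(geq_leqif (mxrank_leqif_sup kNM)) !mxrank_ker leq_sub2l.
  have : mu *m N = 0.
    by apply/sub_kermxP; apply: submx_trans kMN; apply/sub_kermxP.
  rewrite NE mul_mx_row -row_mx0.
  move=> /eq_row_mx[_ /matrixP/(_ 0 0)]; rewrite !mxE => mu0'.
  by case/eqP: mut; rewrite -[RHS]mu0'; apply: eq_bigr => k _; rewrite !mxE.
have [m [s rk]] := step d (leqnn d).
by exists m, s; rewrite -row_leq_rank.
Qed.

End Sampling.

Definition lin_indep (F : fieldType) (V : lmodType F) (d : nat)
    (v : 'I_d -> V) :=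
  forall mu : 'I_d -> F, \sum_(k < d) mu k *: v k = 0 -> forall k, mu k = 0.

Lemma bop_sumE (R : realType) (V : normedModType R[i]) (d : nat)
    (T : 'I_d -> 'L(V)) x : (\sum_(k < d) T k) x = \sum_(k < d) T k x.
Proof. exact: (big_morph (fun S : 'L(V) => S x)). Qed.

Section TensorRank.
Context {R : realType} {X : normedModType R[i]}.

(** The matrix coefficients a |-> g (a y) separate operators, so independent
operators are independent functions of the pair (g, y). *)
Lemma lin_indep_sample d (a : 'I_d -> 'L(X)) : lin_indep a ->
  exists m (s : 'I_m -> functional X * X),
    row_free (\matrix_(k < d, l < m) (s l).1 (a k (s l).2)).
Proof.
move=> aind.
apply: (row_free_sample (f := fun k (s : functional X * X) => s.1 (a k s.2))).
move=> mu muE; apply: aind; apply: bop_ext => x; rewrite bop0E.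
apply: functional_separate => g; rewrite -[RHS](muE (g, x)) /=.
by rewrite bop_sumE linear_sum; apply: eq_bigr => k _; rewrite linearZ.
Qed.

Lemma mulop_sumE d (a b : 'I_d -> 'L(X)) (g f : functional X) x y :
  g ((\sum_(k < d) mulop (a k) (b k)) (rank1 f y) x) =
  \sum_(k < d) g (a k y) * f (b k x).
Proof.
rewrite !bop_sumE linear_sum; apply: eq_bigr => k _.
by rewrite /= linearZ /= linearZ mulrC.
Qed.

(** Sampling both sides gives an equality of matrices M_a^T M_b = M_c^T M_e. The
left side has rank d since M_a and M_b are row free, and the right side factors
through a space of dimension n. *)
Lemma mulops_rank d n (a b : 'I_d -> 'L(X)) (c e : 'I_n -> 'L(X)) :
  lin_indep a -> lin_indep b ->
  \sum_(k < d) mulop (a k) (b k) = \sum_(i < n) mulop (c i) (e i) ->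
  (d <= n)%N.
Proof.
move=> /lin_indep_sample[m [s sfree]] /lin_indep_sample[m' [t tfree]] E.
pose M k (u : 'I_k -> 'L(X)) l (r : 'I_l -> functional X * X) :=
  \matrix_(i < k, j < l) (r j).1 (u i (r j).2) : 'M[R[i]]_(k, l).
have {}E : (M _ a _ s)^T *m M _ b _ t = (M _ c _ s)^T *m M _ e _ t.
  apply/matrixP => i j; rewrite !mxE.
  transitivity ((s i).1
      ((\sum_(k < d) mulop (a k) (b k)) (rank1 (t j).1 (s i).2) (t j).2)).
    by rewrite mulop_sumE; apply: eq_bigr => k _; rewrite !mxE.
  by rewrite E mulop_sumE; apply: eq_bigr => k _; rewrite !mxE.
have -> : d = \rank ((M _ a _ s)^T *m M _ b _ t).
  by rewrite mxrankMfree// mxrank_tr; apply/esym/eqP.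
rewrite E (leq_trans (mxrankM_maxr _ _))//; exact: rank_leq_row.
Qed.

End TensorRank.

(** * Polynomials in a bounded operator *)

Section PolyBop.
Context {R : realType} {X : normedModType R[i]}.
Implicit Types (p q : {poly R[i]}) (T : 'L(X)).

Lemma poly_bopD p q T : poly_bop (p + q) T = poly_bop p T + poly_bop q T.
Proof.
pose n := maxn (size p) (size q).
rewrite (poly_bop_widen _ (size_polyD p q)).
rewrite (poly_bop_widen _ (leq_maxl _ _ : size p <= n)%N).
rewrite (poly_bop_widen _ (leq_maxr _ _ : size q <= n)%N) -big_split /=.
by apply: eq_bigr => i _; rewrite coefD scalerDl.
Qed.

Lemma poly_bopC a T : poly_bop a%:P T = a *: (1 : 'L(X)).
Proof.
by rewrite (poly_bop_widen _ (size_polyC_leq1 a)) big_ord1 coefC /= expr0.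
Qed.

Lemma poly_bop0 T : poly_bop 0 T = 0.
Proof. by rewrite poly_bopC scale0r. Qed.

Lemma poly_bop1 T : poly_bop 1 T = 1.
Proof. by rewrite poly_bopC scale1r. Qed.

Lemma poly_bopMX p T : poly_bop (p * 'X) T = poly_bop p T * T.
Proof.
have sp : (size (p * 'X)%R <= (size p).+1)%N.
  by rewrite (leq_trans (size_polyMleq _ _))// size_polyX addn2.
rewrite (poly_bop_widen _ sp) big_ord_recl coefMX eqxx scale0r add0r mulr_suml.
by apply: eq_bigr => i _; rewrite coefMX /= -bopZAl exprSr.
Qed.

Lemma poly_bopM p q T : poly_bop (p * q) T = poly_bop p T * poly_bop q T.
Proof.
elim/poly_ind: q => [|q a IHq]; first by rewrite mulr0 poly_bop0 mulr0.
rewrite mulrDr mulrA !poly_bopD !poly_bopMX IHq mulrDr mulrA; congr (_ + _).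
by rewrite mulrC mul_polyC poly_bopZ poly_bopC -bopZAr mulr1.
Qed.

Lemma poly_bopX T : poly_bop 'X T = T.
Proof. by rewrite -['X]mul1r poly_bopMX poly_bop1 mul1r. Qed.

Lemma poly_bop_sum d (f : 'I_d -> {poly R[i]}) T :
  poly_bop (\sum_(k < d) f k) T = \sum_(k < d) poly_bop (f k) T.
Proof.
apply: (big_morph (fun p => poly_bop p T)) => [p q|]; first exact: poly_bopD.
exact: poly_bop0.
Qed.

Lemma poly_bop_comm p T : poly_bop p T * T = T * poly_bop p T.
Proof. by rewrite -poly_bopMX mulrC poly_bopM poly_bopX. Qed.

(** The inequality d <= deg T, in a form which treats algebraic and
non-algebraic T uniformly. *)
Definition deg_ge T (d : nat) : Prop :=
  forall p, (size p <= d)%N -> poly_bop p T = 0 -> p = 0.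

Lemma lin_indep_poly_bop d (f : 'I_d -> {poly R[i]}) T :
  deg_ge T d -> (forall k, size (f k) <= d)%N -> lin_indep f ->
  lin_indep (fun k => poly_bop (f k) T).
Proof.
move=> Td fd find mu muE; apply: find; apply: Td.
  apply: (leq_trans (size_sum _ _ _)); apply/bigmax_leqP => k _.
  exact: leq_trans (size_scale_leq _ _) (fd k).
by rewrite poly_bop_sum -[RHS]muE; apply: eq_bigr => k _; rewrite poly_bopZ.
Qed.

End PolyBop.

(** * Newton polynomials and a telescoping identity *)

Section Telescope.
Context {F : fieldType}.
Implicit Types (x : nat -> F) (d k : nat).

(** The Newton interpolation basis at the nodes x. *)
Definition newton x k : {poly F} := \prod_(i < k) ('X - (x i)%:P).

(** Evaluation at x 0 kills all terms but the first; then divide by X - x 0 and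
iterate. The cofactors r let the same argument treat a graduation by degree (r =
1) and one by the order of vanishing at 0 (x = 0). *)
Lemma lin_indep_newton d x (r : nat -> {poly F}) :
  (forall k, (k < d)%N -> (r k).[x k] != 0) ->
  lin_indep (fun k : 'I_d => newton x k * r k).
Proof.
move=> rx mu muE.
(* the induction shifts indices, which is smoother for sequences over nat *)
suff H : forall d x r (mu : nat -> F),
    (forall k, (k < d)%N -> (r k).[x k] != 0) ->
    \sum_(k < d) mu k *: (newton x k * r k) = 0 ->
    forall k, (k < d)%N -> mu k = 0.
  move=> k; pose nu i := if insub i is Some j then mu j else 0.
  have nuE (i : 'I_d) : nu i = mu i by rewrite /nu valK.
  rewrite -nuE; apply: (H d x r) => //.
  by rewrite -[RHS]muE; apply: eq_bigr => i _; rewrite nuE.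
move=> {muE mu rx r x}d; elim: d => // d IHd x r mu rx.
rewrite big_ord_recl /newton big_ord0 mul1r => muE.
pose s := \sum_(k < d) mu k.+1 *: (newton (x \o S) k * r k.+1).
have {}muE : mu 0%N *: r 0%N + ('X - (x 0%N)%:P) * s = 0.
  rewrite -[RHS]muE; congr (_ + _); rewrite mulr_sumr; apply: eq_bigr => k _.
  by rewrite big_ord_recl /= -scalerAr mulrA.
have mu0 : mu 0%N = 0.
  have /(congr1 (horner^~ (x 0%N))) := muE; rewrite !hornerE subrr mul0r addr0.
  by move/eqP; rewrite mulf_eq0 (negPf (rx _ _)) ?orbF// => /eqP.
move: muE; rewrite mu0 scale0r add0r => /eqP.
rewrite mulf_eq0 polyXsubC_eq0 => /eqP s0.
case=> // k kd; apply: (IHd (x \o S) (r \o S) (mu \o S)) => //.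
by move=> i id; apply: rx.
Qed.

Lemma size_newton x k : size (newton x k) = k.+1.
Proof.
rewrite /newton -(big_mkord xpredT (fun i => 'X - (x i)%:P)).
by rewrite size_prod_XsubC size_iota subn0.
Qed.

(** Chosen so that (1 + x_k X) n_k + X n_(k-1) = 0 for 0 < k < d: this makes the
products with 1 + X (x) X in [telescope] cancel. *)
Definition dual_newton x d k : {poly F} :=
  (- 'X) ^+ k * \prod_(k.+1 <= j < d) (1 + x j *: 'X).

(** In the tensor product, (1 + X (x) X) times the sum of the p_k (x) n_k.
Writing X p_k = p_(k+1) + x_k p_k and m_k for (- X)^k times the product of the 1
+ x_j X, k <= j < d, the k-th term is p_k (x) m_k - p_(k+1) (x) m_(k+1). Only a
bilinear map b is assumed, so that either factor may be sent to either of two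
operators. *)
Lemma telescope (V : zmodType) (b : {poly F} -> {poly F} -> V) x d :
  (forall p p' q, b (p + p') q = b p q + b p' q) ->
  (forall p q q', b p (q + q') = b p q + b p q') ->
  (forall a p q, b (a *: p) q = b p (a *: q)) ->
  \sum_(k < d) (b (newton x k) (dual_newton x d k) +
    b ('X * newton x k) ('X * dual_newton x d k)) =
  b 1 (\prod_(0 <= j < d) (1 + x j *: 'X)) - b (newton x d) ((- 'X) ^+ d).
Proof.
move=> bDl bDr bZ.
have b0r p : b p 0 = 0 by apply: (@addrI _ (b p 0)); rewrite -bDr !addr0.
have bNr p q : b p (- q) = - b p q.
  by apply/eqP; rewrite -addr_eq0 -bDr addNr b0r.
pose m k := (- 'X) ^+ k * \prod_(k <= j < d) (1 + x j *: 'X) : {poly F}.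
pose f k := - b (newton x k) (m k).
transitivity (\sum_(0 <= k < d) (f k.+1 - f k)).
  rewrite big_mkord; apply: eq_bigr => k _; rewrite /f opprK [RHS]addrC.
  set n := dual_newton x d k.
  have mk : m k = n + x k *: 'X * n.
    by rewrite /m big_ltn// /n /dual_newton mulrCA mulrDl mul1r.
  have mk1 : m k.+1 = - ('X * n) by rewrite /m exprS -mulrA mulNr.
  have newtonS : newton x k.+1 = 'X * newton x k - x k *: newton x k.
    by rewrite /newton big_ord_recr /= mulrC mulrBl mul_polyC.
  rewrite mk mk1 bDr newtonS bNr opprK bDl -scaleNr bZ scaleNr bNr scalerAl.
  by rewrite -addrA [X in _ = _ + X]addrC subrK.
rewrite telescope_sumr// /f opprK addrC /m /newton big_ord0 expr0 mul1r.
by rewrite [X in _ - b _ (_ * X)]big_geq ?mulr1.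
Qed.

End Telescope.

Section DualNewton.
Context {F : fieldType}.
Implicit Types (x : nat -> F) (d k : nat).

Lemma size_prod_1DZX x k d :
  (size (\prod_(k <= j < d) (1 + x j *: 'X) : {poly F})%R <= (d - k).+1)%N.
Proof.
have [dk|kd] := leqP d k; first by rewrite big_geq// size_poly1.
elim: d kd => // d IHd; rewrite ltnS => kd; rewrite big_nat_recr//=.
rewrite (leq_trans (size_polyMleq _ _))// subSn//.
have szl : (size (1 + x d *: 'X)%R <= 2)%N.
  rewrite (leq_trans (size_polyD _ _))// geq_max size_poly1 /=.
  by rewrite (leq_trans (size_scale_leq _ _))// size_polyX.
have szp :
    (size (\prod_(k <= j < d) (1 + x j *: 'X) : {poly F})%R <= (d - k).+1)%N.
  move: kd; rewrite leq_eqVlt => /predU1P[->|/IHd//].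
  by rewrite big_geq// size_poly1.
by move: szl szp; clear; set a := size _; set b := size _; lia.
Qed.

Lemma size_dual_newton x d k : (k < d)%N -> (size (dual_newton x d k) <= d)%N.
Proof.
move=> kd; have szX : size ((- 'X : {poly F}) ^+ k) = k.+1.
  by rewrite exprNn -signr_odd; case: odd;
    rewrite ?expr0 ?expr1 ?mul1r ?mulN1r ?size_polyN size_polyXn.
rewrite (leq_trans (size_polyMleq _ _))// szX addSn /=.
rewrite (leq_trans (leq_add (leqnn k) (size_prod_1DZX x k.+1 d)))//.
by rewrite subnSK// subnKC// ltnW.
Qed.

Lemma newton0 k : newton (fun=> 0 : F) k = 'X^k.
Proof.
rewrite /newton (eq_bigr (fun=> 'X)) ?prodr_const ?card_ord// => i _.
by rewrite subr0.
Qed.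

(** The polynomial n_k vanishes at 0 to order exactly k. *)
Lemma lin_indep_dual_newton x d : lin_indep (fun k : 'I_d => dual_newton x d k).
Proof.
have -> : (fun k : 'I_d => dual_newton x d k) = (fun k : 'I_d =>
    newton (fun=> 0) k * ((-1) ^+ k * \prod_(k.+1 <= j < d) (1 + x j *: 'X))).
  apply/funext => k.
  by rewrite newton0 /dual_newton [(- 'X) ^+ k]exprNn -mulrA mulrCA.
apply: (@lin_indep_newton _ d (fun=> 0)
  (fun k => (-1) ^+ k * \prod_(k.+1 <= j < d) (1 + x j *: 'X))) => k kd.
rewrite hornerM -(rmorphN1 (@polyC F)) -rmorphXn hornerC mulf_neq0 ?signr_eq0//.
rewrite horner_prod big1 ?oner_eq0// => j _.
by rewrite !hornerE ?mulr0 ?addr0.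
Qed.

End DualNewton.

(** * Linear independence and length *)

Section LinIndepBop.
Context {R : realType} {X : normedModType R[i]}.
Implicit Types (S T W : 'L(X)).

Lemma lin_indep_mull W W' d (v : 'I_d -> 'L(X)) :
  W * W' = 1 -> lin_indep v -> lin_indep (fun k => W' * v k).
Proof.
move=> WW' vind mu muE; apply: vind.
rewrite -[LHS]mul1r -WW' -mulrA -[RHS](mulr0 W) -[in RHS]muE mulr_sumr.
by congr (_ * _); apply: eq_bigr => k _; rewrite bopZAr.
Qed.

Lemma lin_indep_mulr W W' d (v : 'I_d -> 'L(X)) :
  W' * W = 1 -> lin_indep v -> lin_indep (fun k => v k * W').
Proof.
move=> WW' vind mu muE; apply: vind.
rewrite -[LHS]mulr1 -WW' mulrA -[RHS](mul0r W) -[in RHS]muE mulr_suml.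
by congr (_ * _); apply: eq_bigr => k _; rewrite bopZAl.
Qed.

Lemma oplength_lin_indep d (a b : 'I_d -> 'L(X)) :
  lin_indep a -> lin_indep b ->
  oplength (\sum_(k < d) mulop (a k) (b k)) = d%:R%:E.
Proof.
move=> aind bind; rewrite /oplength; case: pselect => [ex|nex]; last first.
  by exfalso; apply: nex; exists d; apply/asboolP; exists a, b.
case: ex_minnP => n /asboolP[c [e E]] nmin; congr (_%:R%:E).
apply/eqP; rewrite eqn_leq (mulops_rank aind bind E) andbT.
by apply: nmin; apply/asboolP; exists a, b.
Qed.

Lemma deg_ge_opdeg T d : (d%:R%:E <= opdeg T)%E -> deg_ge T d.
Proof.
move=> dT p pd pT; apply/eqP; apply: contrapT => /negP p0.
have aT : algebraic T by exists p.
have [mmon mT mmin] := minpolyP aT.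
move: dT; rewrite /opdeg asboolT// lee_fin ler_nat => dm.
have := leq_trans (leq_trans (mmin p p0 pT) pd) dm.
have : (0 < size (minpoly T))%N by rewrite size_poly_gt0 monic_neq0.
by case: size => // n _; rewrite ltnn.
Qed.

Lemma deg_ge_not_algebraic T d : ~ algebraic T -> deg_ge T d.
Proof. by move=> nT; apply: deg_ge_opdeg; rewrite /opdeg asboolF// leey. Qed.

Lemma lin_indep_newton_bop T (x : nat -> R[i]) d : deg_ge T d ->
  lin_indep (fun k : 'I_d => poly_bop (newton x k) T).
Proof.
move=> Td; apply: lin_indep_poly_bop => //.
  by move=> k; rewrite size_newton.
have -> : (fun k : 'I_d => newton x k) = (fun k : 'I_d => newton x k * 1).
  by apply/funext => k; rewrite mulr1.
by apply: (@lin_indep_newton _ d x (fun=> 1)) => k _; rewrite hornerC oner_eq0.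
Qed.

Lemma lin_indep_dual_newton_bop T (x : nat -> R[i]) d : deg_ge T d ->
  lin_indep (fun k : 'I_d => poly_bop (dual_newton x d k) T).
Proof.
move=> Td; apply: lin_indep_poly_bop => //.
  by move=> k; apply: size_dual_newton.
exact: lin_indep_dual_newton.
Qed.

(** A root x_j splits the minimal polynomial as q (X - x_j), and Q = q(T) is
nonzero by minimality. Q plays the role of a projection onto an eigenspace. *)
Lemma minpoly_newton T : algebraic T ->
  exists d (x : nat -> R[i]), [/\ opdeg T = d%:R%:E,
    poly_bop (newton x d) T = 0 &
    forall j, (j < d)%N -> exists Q : 'L(X),
      [/\ Q != 0, T * Q = x j *: Q & Q * T = x j *: Q]].
Proof.
move=> aT; have [mmon mT mmin] := minpolyP aT.
have [r mE] := closed_field_poly_normal (minpoly T).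
move: mE; rewrite (monicP mmon) scale1r => mE.
have mN : newton (nth 0 r) (size r) = minpoly T.
  by rewrite mE (big_nth 0) big_mkord.
exists (size r), (nth 0 r); split.
- by rewrite /opdeg asboolT// -mN size_newton.
- by rewrite mN.
- move=> j jr.
  have /dvdpP[q mq] : ('X - (nth 0 r j)%:P %| minpoly T)%R.
    by rewrite dvdp_XsubCl mE root_prod_XsubC mem_nth.
  exists (poly_bop q T).
  have qX : poly_bop q T * (T - nth 0 r j *: (1 : 'L(X))) = 0.
    rewrite -[RHS]mT mq poly_bopM poly_bopD poly_bopX; congr (_ * (_ + _)).
    by rewrite -polyCN poly_bopC scaleNr.
  have qT : poly_bop q T * T = nth 0 r j *: poly_bop q T.
    apply/eqP; rewrite -subr_eq0; move/eqP: qX.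
    by rewrite mulrBr -bopZAr mulr1.
  split=> //; last by rewrite -poly_bop_comm.
  have m0 := monic_neq0 mmon.
  have q0 : q != 0 by apply: contraNneq m0 => q0; rewrite mq q0 mul0r.
  apply/eqP => qT0; have := mmin q q0 qT0.
  by rewrite mq size_Mmonic ?monicXsubC// size_XsubC addn2 ltnn.
Qed.

Lemma invertible_poly_prod T (x : nat -> R[i]) d :
  (forall j, (j < d)%N -> invertible (1 + x j *: T)) ->
  invertible (poly_bop (\prod_(0 <= j < d) (1 + x j *: 'X)) T).
Proof.
elim: d => [|d IHd] inv.
  by rewrite big_geq// poly_bop1; exists 1; split; rewrite mulr1.
have [|U [UW WU]] := IHd; first by move=> j jd; apply: inv; exact: ltnW.
have [V [VE EV]] := inv d (leqnn _).
exists (V * U).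
rewrite big_nat_recr//= poly_bopM poly_bopD poly_bop1 poly_bopZ poly_bopX.
split; rewrite mulrA.
  by rewrite -(mulrA V) UW mulr1.
by rewrite -(mulrA _ _ V) EV mulr1.
Qed.

End LinIndepBop.

Section SumOfMulops.
Context {R : realType} {X : normedModType R[i]}.
Implicit Types (Phi Psi : 'L('L(X))).

Lemma sum_of_mulopsD Phi Psi m n :
  sum_of_mulops Phi m -> sum_of_mulops Psi n ->
  sum_of_mulops (Phi + Psi) (m + n).
Proof.
move=> [a [b ->]] [c [e ->]].
pose glue (u : 'I_m -> 'L(X)) (v : 'I_n -> 'L(X)) i :=
  match fintype.split i with inl j => u j | inr j => v j end.
have gl u v i : glue u v (lshift n i) = u i.
  by rewrite /glue (unsplitK (inl _ i)).
have gr u v i : glue u v (rshift m i) = v i.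
  by rewrite /glue (unsplitK (inr _ i)).
exists (glue a c), (glue b e); rewrite big_split_ord /=.
by congr (_ + _); apply: eq_bigr => i _; rewrite ?gl ?gr.
Qed.

Lemma sum_of_mulopsM Phi n (u v : 'L(X)) :
  sum_of_mulops Phi n -> sum_of_mulops (Phi * mulop u v) n.
Proof.
move=> [a [b ->]]; exists (fun i => a i * u), (fun i => v * b i).
rewrite mulr_suml; apply: eq_bigr => i _; apply: bop_ext => T.
by rewrite bopME /= !mulrA.
Qed.

End SumOfMulops.

(** * Invertibility of the factors 1 + l A and 1 + l B *)

Section Range.
Context {R : realType} {X : normedModType R[i]}.
Implicit Types (x y z : X) (S T : 'L(X)).
Local Open Scope complex_scope.
Local Open Scope classical_set_scope.

(** Hahn-Banach for the seminorm p x = distance from x to the range of T: the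
functional it gives vanishes on the range, hence everywhere, so p z = 0. *)
Lemma dense_range T :
  (forall g : functional X, (forall x, g (T x) = 0) -> forall x, g x = 0) ->
  forall z (e : R[i]), 0 < e -> exists y, `|z - T y| < e.
Proof.
move=> gT z e e0.
pose D x := [set complex.Re `|x - T y| | y in setT].
have D0 x : D x !=set0 by exists (complex.Re `|x - T 0|); exists 0.
have Dge0 x : lbound (D x) 0.
  by move=> _ [y _ <-]; rewrite -ler0c Re_norm.
have Dl x : has_lbound (D x) by exists 0.
pose p x := inf (D x).
have pge0 x : 0 <= p x by apply: lb_le_inf.
have ple x y : (p x)%:C <= `|x - T y|.
  by rewrite -Re_norm lecR; apply: ge_inf => //; exists y.
have pD x y : p (x + y) <= p x + p y.
  rewrite -lerBlDl; apply: lb_le_inf => // _ [v _ <-].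
  rewrite lerBlDl -lerBlDr; apply: lb_le_inf => // _ [u _ <-].
  rewrite lerBlDr -lecR rmorphD /= !Re_norm (le_trans (ple _ (u + v)))//.
  by rewrite linearD opprD addrACA ler_normD.
have pZle a x : (p (a *: x))%:C <= `|a| * (p x)%:C.
  have [->|a0] := eqVneq a 0.
    by rewrite scale0r normr0 mul0r (le_trans (ple _ 0))// linear0 subr0 normr0.
  have [r ra] : exists r : R, r%:C = `|a|.
    by exists (complex.Re `|a|); rewrite RRe_real ?normr_real.
  have r0 : 0 < r by rewrite -ltcR ra normr_gt0.
  rewrite -ra -rmorphM lecR mulrC -ler_pdivrMr//.
  apply: lb_le_inf => // _ [y _ <-].
  rewrite ler_pdivrMr// -lecR rmorphM /= ra !Re_norm mulrC -normrZ.
  rewrite scalerBr -linearZ.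
  exact: ple.
have pZ a x : (p (a *: x))%:C = `|a| * (p x)%:C.
  apply/eqP; rewrite eq_le pZle /=.
  have [->|a0] := eqVneq a 0; first by rewrite normr0 mul0r ler0c.
  rewrite -ler_pdivlMl ?normr_gt0// -normfV (le_trans _ (pZle _ _))//.
  by rewrite scalerA mulVf// scale1r.
have [f [fS fle fz]] := hahn_banach z pD pZ.
have fle' x : `|f x| <= `|x|.
  by rewrite (le_trans (fle x))// (le_trans (ple x 0))// linear0 subr0.
have pz : p z = 0.
  apply: (@complexI R); rewrite -fz; apply: (gT (Functional fS fle')) => x /=.
  apply/eqP; rewrite -normr_le0 (le_trans (fle _))// (le_trans (ple _ x))//.
  by rewrite subrr normr0.
have e0' : 0 < complex.Re e.
  by rewrite -ltcR RRe_real// gtr0_real.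
have [|_ [y _ <-]] := @inf_adherent _ (D z) _ e0'; first by split.
rewrite -/(p z) pz add0r -ltcR Re_norm RRe_real ?gtr0_real// => ye.
by exists y.
Qed.

Lemma bijective_invertible T (C : R[i]) : 0 <= C ->
  (forall x, `|x| <= C * `|T x|) -> (forall z, exists y, T y = z) ->
  invertible T.
Proof.
move=> C0 TC /choice[K TK].
have Tinj x y : T x = T y -> x = y.
  move=> Txy; apply/eqP; rewrite -subr_eq0 -normr_le0 (le_trans (TC _))//.
  by rewrite linearB /= Txy subrr normr0 mulr0.
have Kb : bounded_linear K.
  split=> [a x y|]; first by apply: Tinj; rewrite linearP /= !TK.
  by exists C => x; have := TC (K x); rewrite TK.
exists (to_bop Kb); split; apply: bop_ext => x; rewrite bopME bop1E /=.
  exact: Tinj.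
exact: TK.
Qed.

End Range.

(** A map bounded below has closed range in a complete space: preimages of
points close to z are close to each other, so they form a Cauchy filter, whose
limit is a preimage of z. *)
Lemma bounded_below_dense_invertible (R : realType)
    (X : completeNormedModType R[i]) (T : 'L(X)) (C : R[i]) : 0 <= C ->
  (forall x, `|x| <= C * `|T x|) ->
  (forall g : functional X, (forall x, g (T x) = 0) -> forall x, g x = 0) ->
  invertible T.
Proof.
move=> C0 TC gT; apply: (bijective_invertible C0) => // z.
have dT := dense_range gT z.
pose F : set_system X := ([set U | exists2 e : R[i], 0 < e &
  forall y, `|z - T y| < e -> U y])%classic.
have FF : ProperFilter F.
  apply: Build_ProperFilter_ex.
    by move=> U [e e0 eU]; have [y /eU] := dT _ e0; exists y.
  split.
  - by exists 1.
  - move=> U W [e e0 eU] [d d0 dW]; exists (Order.min e d).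
      by rewrite comparable_lt_min ?e0// real_comparable ?gtr0_real.
    move=> y; rewrite comparable_lt_min ?real_comparable ?gtr0_real//.
    by move=> /andP[ye yd]; split; [exact: eU|exact: dW].
  - by move=> U W UW [e e0 eU]; exists e => // y /eU /UW.
have Fc : cvg F.
  apply/cauchy_cvgP/cauchy_exP => e e0.
  have C1 : 0 < (C + 1) *+ 2 by rewrite pmulrn_lgt0// ltr_wpDl.
  (* two images within d of z have preimages within C (d + d) < e *)
  pose d := e / ((C + 1) *+ 2).
  have d0 : 0 < d by rewrite divr_gt0.
  have [y yd] := dT _ d0.
  exists y, d => // v vd; rewrite -ball_normE /=.
  rewrite (le_lt_trans (TC _))// linearB /=.
  have -> : e = (C + 1) * (d + d).
    by rewrite -mulr2n mulrnAr -mulrnAl mulrC divfK ?gt_eqF.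
  apply: (@le_lt_trans _ _ (C * (d + d))); last first.
    by rewrite ltr_pM2r ?ltrDl// addr_gt0.
  rewrite ler_wpM2l// -[T y](subrK z) -addrA (le_trans (ler_normD _ _))//.
  by rewrite lerD// ?[`|T y - z|]distrC ltW.
exists (lim F); apply/eqP; rewrite eq_sym -subr_eq0; apply/negPn/negP => zl.
have e0 : 0 < `|z - T (lim F)| by rewrite normr_gt0.
set e := `|_| in e0.
have T1 : 0 < 1 + `|T| by rewrite ltr_pwDl.
(* y within d of the limit and T y within d of z give |z - T (lim F)| < e *)
pose d := e / (1 + `|T|).
have d0 : 0 < d by rewrite divr_gt0.
have [e' e'0 e'l] := Fc _ (nbhsx_ballx (lim F) d d0).
have m0 : 0 < Order.min e' d.
  by rewrite comparable_lt_min ?e'0// real_comparable ?gtr0_real.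
have [y] := dT _ m0.
rewrite comparable_lt_min ?real_comparable ?gtr0_real// => /andP[/e'l].
rewrite -ball_normE /= => ly yd.
suff: e < e by rewrite ltxx.
have {2}-> : e = d + `|T| * d.
  by rewrite -[X in X + _]mul1r -mulrDl mulrC divfK ?gt_eqF.
rewrite /e -(subrK (T y) z) -addrA (le_lt_trans (ler_normD _ _))//.
rewrite ltr_leD// -linearB (le_trans (le_bop_norm _ _))//.
by rewrite ler_wpM2l// distrC ltW.
Qed.

(** Multiplying Upsilon (Psi S) = S by Q on the left gives Q (Psi S) E = Q S,
where E = 1 + l B and Psi is the inverse of Upsilon. For S of rank one, with a
functional norming x, this bounds E from below at x. If a functional g vanishes
on the range of E, then Upsilon kills the rank-one operator g (x) Q z, so g = 0
by injectivity, and E has dense range. *)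
Lemma eigen_left_invertible (R : realType) (X : completeNormedModType R[i])
    (A B Q : 'L(X)) (l : R[i]) :
  invertible (Upsilon A B) -> Q != 0 ->
  A * Q = l *: Q -> Q * A = l *: Q -> invertible (1 + l *: B).
Proof.
move=> /inverseP[]; set Psi := inverse _ => PsiU UPsi Q0 AQ QA.
set E := 1 + l *: B.
have QPsiE S : Q * Psi S * E = Q * S.
  have /(congr1 (fun P : 'L('L(X)) => Q * P S)) := UPsi.
  rewrite bopME bop1E UpsilonE => <-.
  by rewrite !mulrDr mulr1 !mulrA QA -!bopZAl -bopZAr.
have [z Qz] : exists z, Q z != 0.
  apply: contrapT => nz; case/eqP: Q0; apply: bop_ext => z; apply/eqP.
  by apply: contrapT => /negP Qz; apply: nz; exists z.
have nQz : 0 < `|Q z| by rewrite normr_gt0.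
pose C := `|Q| * (`|Psi| * `|z|) / `|Q z|.
apply: (@bounded_below_dense_invertible _ _ _ C).
- by rewrite /C divr_ge0 ?mulr_ge0.
- rewrite /C => x; have [g gx] := norming_functional x.
  rewrite mulrAC ler_pdivlMr// -normr_id -gx -normrZ.
  have -> : g x *: Q z = Q (Psi (rank1 g z) (E x)).
    have /(congr1 (fun T : 'L(X) => T x)) := QPsiE (rank1 g z).
    by rewrite !bopME /= linearZ.
  rewrite (le_trans (le_bop_norm _ _))// -mulrA ler_wpM2l//.
  rewrite (le_trans (le_bop_norm _ _))// ler_wpM2r//.
  rewrite (le_trans (le_bop_norm _ _))// ler_wpM2l//.
  exact: norm_rank1.
- move=> g gE x.
  have rank0 : Upsilon A B (rank1 g (Q z)) = 0.
    apply: bop_ext => y; rewrite UpsilonE bopDE !bopME /= linearZ /=.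
    have -> : A (Q z) = l *: Q z by rewrite -bopME AQ.
    have := gE y; rewrite -[E y]/(y + l *: B y) linearD linearZ /= => gEy.
    by rewrite scalerA -scalerDl mulrC gEy scale0r.
  have : rank1 g (Q z) = 0.
    by rewrite -[LHS]bop1E -PsiU bopME rank0 linear0.
  move=> /(congr1 (fun T : 'L(X) => T x)) /= /eqP.
  by rewrite scaler_eq0 (negPf Qz) orbF => /eqP.
Qed.

(** Here E (Psi S) Q = S Q with E = 1 + l A, and evaluation at a vector u
outside the kernel of Q, for S of rank one with range spanned by w, solves E y =
w explicitly and boundedly. *)
Lemma eigen_right_invertible (R : realType) (X : normedModType R[i])
    (A B Q : 'L(X)) (l : R[i]) :
  invertible (Upsilon A B) -> Q != 0 ->
  B * Q = l *: Q -> Q * B = l *: Q -> invertible (1 + l *: A).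
Proof.
move=> /inverseP[]; set Psi := inverse _ => PsiU UPsi Q0 BQ QB.
set E := 1 + l *: A.
have EPsiQ S : E * Psi S * Q = S * Q.
  have /(congr1 (fun P : 'L('L(X)) => P S * Q)) := UPsi.
  rewrite bopME bop1E UpsilonE => <-.
  by rewrite !mulrDl mul1r -!mulrA BQ -!bopZAr -!bopZAl.
have [u Qu] : exists u, Q u != 0.
  apply: contrapT => nz; case/eqP: Q0; apply: bop_ext => z; apply/eqP.
  by apply: contrapT => /negP Qz; apply: nz; exists z.
have [g gQu] := norming_functional (Q u).
have gQu0 : g (Q u) != 0 by rewrite gQu normr_eq0.
pose K w := (g (Q u))^-1 *: Psi (rank1 g w) (Q u).
have rank1P a v w : rank1 g (a *: v + w) = a *: rank1 g v + rank1 g w.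
  apply: bop_ext => x; rewrite bopDE bopZE /= scalerDr !scalerA.
  by rewrite [a * _]mulrC.
have Kb : bounded_linear K.
  split=> [a v w|].
    by rewrite /K rank1P linearP bopDE bopZE scalerDr !scalerA [a * _]mulrC.
  exists (`|(g (Q u))^-1| * (`|Psi| * `|Q u|)) => w.
  rewrite normrZ -mulrA ler_wpM2l// (le_trans (le_bop_norm _ _))//.
  rewrite mulrAC ler_wpM2r// (le_trans (le_bop_norm _ _))// ler_wpM2l//.
  exact: norm_rank1.
have EK w : E (K w) = w.
  have /(congr1 (fun T : 'L(X) => T u)) := EPsiQ (rank1 g w).
  rewrite !bopME => EPsi.
  transitivity ((g (Q u))^-1 *: E (Psi (rank1 g w) (Q u))).
    exact: linearZ.
  by rewrite EPsi /= scalerA mulVf// scale1r.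
have E0 x : E x = 0 -> x = 0.
  move=> Ex.
  have rank0 : Upsilon A B (rank1 g x * Q) = 0.
    rewrite UpsilonE -!mulrA QB -!bopZAr; apply: bop_ext => y.
    rewrite bopDE bopZE !bopME /= linearZ scalerA mulrC -scalerA -scalerDr.
    by rewrite -[X in _ *: X]/(E x) Ex scaler0.
  have : rank1 g x * Q = 0.
    by rewrite -[LHS]bop1E -PsiU bopME rank0 linear0.
  move=> /(congr1 (fun T : 'L(X) => T u)) /= /eqP.
  by rewrite scaler_eq0 (negPf gQu0) => /eqP.
exists (to_bop Kb); split; apply: bop_ext => x; rewrite bopME bop1E.
  apply/eqP; rewrite -subr_eq0; apply/eqP/E0.
  have -> : E (K (E x) - x) = E (K (E x)) - E x by exact: linearB.
  by rewrite EK subrr.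
exact: EK.
Qed.

(** * The inverse of Upsilon *)

Section Main.
Context {R : realType} {X : completeNormedModType R[i]}.
Context (A B : 'L(X)).
Implicit Types (p q : {poly R[i]}) (x : nat -> R[i]).

Definition mulop_poly p q := mulop (poly_bop p A) (poly_bop q B).

Lemma mulop_polyE p q T : mulop_poly p q T = poly_bop p A * T * poly_bop q B.
Proof. by []. Qed.

Lemma mulop_polyDl p p' q :
  mulop_poly (p + p') q = mulop_poly p q + mulop_poly p' q.
Proof.
by apply: bop_ext => T; rewrite bopDE !mulop_polyE poly_bopD !mulrDl.
Qed.

Lemma mulop_polyDr p q q' :
  mulop_poly p (q + q') = mulop_poly p q + mulop_poly p q'.
Proof.
by apply: bop_ext => T; rewrite bopDE !mulop_polyE poly_bopD !mulrDr.
Qed.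

Lemma mulop_polyZ a p q : mulop_poly (a *: p) q = mulop_poly p (a *: q).
Proof.
by apply: bop_ext => T; rewrite !mulop_polyE !poly_bopZ -!bopZAl -bopZAr.
Qed.

Lemma mulop_poly0l q p : poly_bop p A = 0 -> mulop_poly p q = 0.
Proof. by move=> pA; apply: bop_ext => T; rewrite mulop_polyE pA !mul0r. Qed.

Lemma mulop_poly0r q p : poly_bop q B = 0 -> mulop_poly p q = 0.
Proof. by move=> pA; apply: bop_ext => T; rewrite mulop_polyE pA !mulr0. Qed.

(** Left multiplication by A and right multiplication by B commute, so Upsilon
acts on the tensors p (x) q of polynomials as multiplication by 1 + X (x) X. *)
Lemma Upsilon_mulop_poly p q :
  Upsilon A B * mulop_poly p q = mulop_poly p q + mulop_poly ('X * p) ('X * q).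
Proof.
apply: bop_ext => T; rewrite bopME UpsilonE bopDE !mulop_polyE.
by rewrite !poly_bopM !poly_bopX -[B * _]poly_bop_comm !mulrA.
Qed.

Lemma Upsilon_newton_dual x d :
  Upsilon A B * (\sum_(k < d) mulop_poly (newton x k) (dual_newton x d k)) =
  mulop_poly 1 (\prod_(0 <= j < d) (1 + x j *: 'X)) -
  mulop_poly (newton x d) ((- 'X) ^+ d).
Proof.
rewrite -telescope//; first last.
- exact: mulop_polyZ.
- exact: mulop_polyDr.
- exact: mulop_polyDl.
by rewrite mulr_sumr; apply: eq_bigr => k _; rewrite Upsilon_mulop_poly.
Qed.

Lemma Upsilon_dual_newton x d :
  Upsilon A B * (\sum_(k < d) mulop_poly (dual_newton x d k) (newton x k)) =
  mulop_poly (\prod_(0 <= j < d) (1 + x j *: 'X)) 1 -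
  mulop_poly ((- 'X) ^+ d) (newton x d).
Proof.
rewrite -(@telescope _ _ (fun p q => mulop_poly q p))//; first last.
- by move=> a p q; rewrite mulop_polyZ.
- by move=> p q q'; rewrite mulop_polyDl.
- by move=> p p' q; rewrite mulop_polyDr.
by rewrite mulr_sumr; apply: eq_bigr => k _; rewrite Upsilon_mulop_poly.
Qed.

Lemma is_inverse_inverse (Phi : 'L('L(X))) : invertible (Upsilon A B) ->
  Upsilon A B * Phi = 1 -> inverse (Upsilon A B) = Phi.
Proof.
move=> /inverseP[PU UP] UPhi.
by rewrite -[LHS]mulr1 -UPhi mulrA PU mul1r.
Qed.

Definition independent_expansion (Phi : 'L('L(X))) d :=
  exists a b : 'I_d -> 'L(X),
    [/\ lin_indep a, lin_indep b & Phi = \sum_(k < d) mulop (a k) (b k)].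

(** The telescoping sum, composed with right multiplication by the inverse of W,
the product of the 1 + x_j B. *)
Lemma inverse_left_algebraic : invertible (Upsilon A B) -> algebraic A ->
  (opdeg A <= opdeg B)%E ->
  exists2 d, opdeg A = d%:R%:E &
    independent_expansion (inverse (Upsilon A B)) d.
Proof.
move=> invU aA AB; have [d [x [dA nA eig]]] := minpoly_newton aA.
exists d => //; have Bd : deg_ge B d by apply: deg_ge_opdeg; rewrite -dA.
have Ad : deg_ge A d by apply: deg_ge_opdeg; rewrite -dA.
have [|W' [W'W WW']] := @invertible_poly_prod _ _ B x d.
  move=> j /eig[Q [Q0 AQ QA]]; exact: eigen_left_invertible invU Q0 AQ QA.
exists (fun k => poly_bop (newton x k) A).
exists (fun k => W' * poly_bop (dual_newton x d k) B); split.
- exact: lin_indep_newton_bop.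
- exact: (lin_indep_mull WW' (lin_indep_dual_newton_bop Bd)).
- apply: is_inverse_inverse => //.
  have -> : \sum_(k < d) mulop (poly_bop (newton x k) A)
        (W' * poly_bop (dual_newton x d k) B) =
      (\sum_(k < d) mulop_poly (newton x k) (dual_newton x d k)) * mulop 1 W'.
    rewrite mulr_suml; apply: eq_bigr => k _; apply: bop_ext => T.
    by rewrite bopME /= mul1r !mulrA.
  rewrite mulrA Upsilon_newton_dual (mulop_poly0l _ nA) subr0.
  apply: bop_ext => T; rewrite bopME mulop_polyE poly_bop1 /= !mul1r.
  by rewrite -mulrA W'W mulr1.
Qed.

Lemma inverse_right_algebraic : invertible (Upsilon A B) -> algebraic B ->
  (opdeg B <= opdeg A)%E ->
  exists2 d, opdeg B = d%:R%:E &
    independent_expansion (inverse (Upsilon A B)) d.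
Proof.
move=> invU aB BA; have [d [x [dB nB eig]]] := minpoly_newton aB.
exists d => //; have Bd : deg_ge B d by apply: deg_ge_opdeg; rewrite -dB.
have Ad : deg_ge A d by apply: deg_ge_opdeg; rewrite -dB.
have [|W' [W'W WW']] := @invertible_poly_prod _ _ A x d.
  move=> j /eig[Q [Q0 BQ QB]]; exact: eigen_right_invertible invU Q0 BQ QB.
exists (fun k => poly_bop (dual_newton x d k) A * W').
exists (fun k => poly_bop (newton x k) B); split.
- exact: (lin_indep_mulr W'W (lin_indep_dual_newton_bop Ad)).
- exact: lin_indep_newton_bop.
- apply: is_inverse_inverse => //.
  have -> : \sum_(k < d) mulop (poly_bop (dual_newton x d k) A * W')
        (poly_bop (newton x k) B) =
      (\sum_(k < d) mulop_poly (dual_newton x d k) (newton x k)) * mulop W' 1.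
    rewrite mulr_suml; apply: eq_bigr => k _; apply: bop_ext => T.
    by rewrite bopME /= mulr1 !mulrA.
  rewrite mulrA Upsilon_dual_newton (mulop_poly0r _ nB) subr0.
  apply: bop_ext => T; rewrite bopME mulop_polyE poly_bop1 /= !mulr1.
  by rewrite mulrA WW' mul1r.
Qed.

(** With nodes 0, Upsilon sends the telescoping sum h to 1 - M(A^d, (- B)^d), so
h is a sum of 2 n multiplication operators when Upsilon^-1 is one of n. Neither
A nor B being algebraic, h has d = 2 n + 1 independent terms. *)
Lemma elementary_inverse_algebraic : invertible (Upsilon A B) ->
  elementary (inverse (Upsilon A B)) -> algebraic A \/ algebraic B.
Proof.
move=> invU [n [c [e PhiE]]]; apply: contrapT => /not_orP[nA nB].
have [PU UP] := inverseP invU; set Phi := inverse _ in PhiE PU UP.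
pose d := (n + n).+1; pose x : nat -> R[i] := fun=> 0.
have := Upsilon_newton_dual x d.
have -> : \prod_(0 <= j < d) (1 + x j *: 'X) = 1 :> {poly R[i]}.
  by rewrite big1// => j _; rewrite scale0r addr0.
set h := \sum_(k < d) _ => Uh.
have hE : h = Phi +
    Phi * mulop (- poly_bop (newton x d) A) (poly_bop ((- 'X) ^+ d) B).
  rewrite -[h]mul1r -PU -mulrA Uh mulrBr -mulrN; congr (_ + _ * _).
    by apply: bop_ext => T; rewrite bopME mulop_polyE !poly_bop1 mul1r mulr1.
  by apply: bop_ext => T; rewrite bopNE /= !mulNr.
have PhiS : sum_of_mulops Phi n by exists c, e.
have [c' [e' hE']] : sum_of_mulops h (n + n).
  by rewrite hE; apply: sum_of_mulopsD => //; exact: sum_of_mulopsM.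
have Aind := lin_indep_newton_bop (x := x) (deg_ge_not_algebraic (d := d) nA).
have Bind :=
  lin_indep_dual_newton_bop (x := x) (deg_ge_not_algebraic (d := d) nB).
by have := mulops_rank Aind Bind hE'; rewrite ltnn.
Qed.

Lemma length_inverse : invertible (Upsilon A B) -> algebraic A \/ algebraic B ->
  exists2 d, Order.min (opdeg A) (opdeg B) = d%:R%:E &
    independent_expansion (inverse (Upsilon A B)) d.
Proof.
move=> invU algAB; have [AB|/ltW BA] := leP (opdeg A) (opdeg B).
  have [aA|nA] := pselect (algebraic A); first exact: inverse_left_algebraic.
  case: algAB => // aB; move: AB.
  by rewrite /opdeg (asboolF nA) (asboolT aB).
have [aB|nB] := pselect (algebraic B); first exact: inverse_right_algebraic.
case: algAB => // aA; move: BA.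
by rewrite /opdeg (asboolF nB) (asboolT aA).
Qed.

End Main.

Theorem theorem3 (R : realType) (X : completeNormedModType R[i])
    (A B : 'L(X)) :
  invertible (Upsilon A B) -> oplength (Upsilon A B) = 2%:R%:E ->
  (elementary (inverse (Upsilon A B)) <-> algebraic A \/ algebraic B) /\
  (elementary (inverse (Upsilon A B)) ->
   oplength (inverse (Upsilon A B)) = Order.min (opdeg A) (opdeg B)).
Proof.
move=> invU _; split; first split.
- exact: elementary_inverse_algebraic.
- move=> /(length_inverse invU)[d _ [a [b [_ _ E]]]]; exists d.
  by exists a, b.
- move=> /(elementary_inverse_algebraic invU)/(length_inverse invU).
  by case=> d -> [a [b [aind bind ->]]]; exact: oplength_lin_indep.
Qed.
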